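(* There exist absolute constants $c_3>0$ and $x_0$ such that for every real $x\ge x_0$ the following holds: there exist distinct primes $q,r$ with $x<q\le 2x$ and $x^{1/2}\log x< r\le 2x^{1/2}\log x$ such that the number $qr^2\in B_3$ has at least $c_3\dfrac{x^{1/2}}{\log^2 x}$ different $B_3$-parents of the form $pq^2$, where $p\ne q$ is a prime with $x<p\le 2x$.
   Context: For an integer $n>1$, $P(n)$ denotes the largest prime factor of $n$. Let $C_3=\{p_1p_2p_3: p_1,p_2,p_3 \text{ primes}, p_i\ne p_j \text{ for } i\ne j\}$, and let $B_3$ be the set of products $p_1p_2p_3$ of three primes in which exactly two of the primes are equal (i.e. some two coincide but not all three). Let $A_3=C_3\cup B_3$. For $n=p_1p_2p_3\in A_3$ define $w(n)=P(p_1+p_2)\,P(p_1+p_3)\,P(p_2+p_3)$ (this is independent of the ordering of the prime factors, and $w(n)\in A_3$). For $n\in A_3$, an element $m\in A_3$ with $w(m)=n$ is called a parent of $n$; if moreover $m\in B_3$ it is called a $B_3$-parent of $n$. ''Different'' parents means different integers $m$. $\log$ is the natural logarithm. *)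

(* Defs.v *)
From mathcomp Require Import all_boot all_order all_algebra.
From mathcomp Require Import classical_sets reals exp.

Set Implicit Arguments.
Unset Strict Implicit.
Unset Printing Implicit Defensive.

Local Open Scope classical_set_scope.

(* The largest prime factor P(n) of n > 1 is the library's [max_pdiv n].      *)

Definition C3 : set nat :=
  [set n | exists p1 p2 p3, [/\ prime p1, prime p2, prime p3,
     [&& p1 != p2, p1 != p3 & p2 != p3] & n = p1 * p2 * p3]].

Definition B3 : set nat :=
  [set n | exists p1 p2 p3, [/\ prime p1, prime p2, prime p3,
     [|| p1 == p2, p1 == p3 | p2 == p3] && ~~ [&& p1 == p2 & p1 == p3]
     & n = p1 * p2 * p3]].

Definition A3 : set nat := C3 `|` B3.

(* The prime factors of n in increasing order, repeated with multiplicity.    *)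
Definition prime_factors (n : nat) : seq nat := tally_seq (prime_decomp n).

(* Only meaningful on products of three primes, see [wE]; the value 0
   elsewhere is junk.                                                         *)
Definition w (n : nat) : nat :=
  if prime_factors n is [:: p1; p2; p3]
  then max_pdiv (p1 + p2) * max_pdiv (p1 + p3) * max_pdiv (p2 + p3)
  else 0.

(* m is a parent of n. *)
Definition parent (n m : nat) : Prop := [/\ A3 n, A3 m & w m = n].

Definition B3_parent (n m : nat) : Prop := parent n m /\ B3 m.

Lemma count_prime_factors p n : count_mem p (prime_factors n) = logn p n.
Proof.
rewrite /prime_factors /tally_seq prime_decompE -map_comp count_flatten -map_comp.
rewrite (eq_map (g := fun q => (q == p) * logn q n)); last first.
  by move=> q /=; rewrite count_nseq.
rewrite sumnE big_map.
have [pn|pn] := boolP (p \in primes n).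
  rewrite (bigD1_seq p) ?primes_uniq //= eqxx mul1n big1 ?addn0 // => q.
  by move=> /negPf ->.
rewrite big1_seq => [|q /= qn].
  by apply/esym/eqP; rewrite -leqn0 leqNgt logn_gt0.
by case: eqP => // qp; rewrite -qp qn in pn.
Qed.

Lemma prime_factors3 p1 p2 p3 : prime p1 -> prime p2 -> prime p3 ->
  perm_eq (prime_factors (p1 * p2 * p3)) [:: p1; p2; p3].
Proof.
move=> P1 P2 P3; apply/allP => p _ /=.
rewrite count_prime_factors !lognM ?muln_gt0 ?prime_gt0 //.
apply/eqP; rewrite addn0 !addnA.
have [pp|npp] := boolP (prime p); first by rewrite !logn_prime // !(eq_sym p).
have np q : prime q -> (q == p) = false.
  by move=> Pq; apply/negP => /eqP qp; rewrite -qp Pq in npp.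
by rewrite !np // /logn (negPf npp).
Qed.

Lemma perm_eq2 (a b c d : nat) : perm_eq [:: a; b] [:: c; d] ->
  (a = c /\ b = d) \/ (a = d /\ b = c).
Proof.
move=> pe; have : a \in [:: c; d] by rewrite -(perm_mem pe) mem_head.
rewrite !inE => /orP[] /eqP E; move: pe; rewrite E.
  by rewrite perm_cons => /perm_small_eq-/(_ isT) [->]; left.
have e : perm_eq [:: c; d] [:: d; c] by exact: permEl (perm_catC [:: c] [:: d]).
move=> pe; move: (perm_trans pe e); rewrite perm_cons.
by move=> /perm_small_eq-/(_ isT) [->]; right.
Qed.

Lemma wE p1 p2 p3 : prime p1 -> prime p2 -> prime p3 ->
  w (p1 * p2 * p3) = max_pdiv (p1 + p2) * max_pdiv (p1 + p3) * max_pdiv (p2 + p3).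
Proof.
move=> P1 P2 P3; have pe := prime_factors3 P1 P2 P3.
rewrite /w; case: (prime_factors _) pe (perm_size pe) => [|a [|b [|c [|]]]] // pe _.
have [A|A] := boolP (a == p1).
  move: pe; rewrite (eqP A) perm_cons => /perm_eq2 [[-> ->]|[-> ->]] //.
  by rewrite (addnC p3 p2) [X in X * _]mulnC.
have [B|B] := boolP (a == p2).
  have e : perm_eq [:: p1; p2; p3] [:: p2; p1; p3]
    by exact: permEl (perm_catCA [:: p1] [:: p2] [:: p3]).
  move: (perm_trans pe e); rewrite (eqP B) perm_cons => /perm_eq2 [[-> ->]|[-> ->]].
    by rewrite (addnC p2 p1) mulnAC.
  by rewrite (addnC p2 p1) (addnC p3 p1) -mulnA mulnC.
have: a \in [:: p1; p2; p3] by rewrite -(perm_mem pe) mem_head.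
rewrite !inE (negPf A) (negPf B) /= => /eqP C.
have e : perm_eq [:: p1; p2; p3] [:: p3; p1; p2]
  by exact: permEl (perm_catC [:: p1; p2] [:: p3]).
move: (perm_trans pe e); rewrite C perm_cons => /perm_eq2 [[-> ->]|[-> ->]].
  by rewrite !(addnC p3) mulnC mulnA.
by rewrite !(addnC p3) (addnC p2 p1) mulnC [X in _ * X]mulnC mulnA.
Qed.

(* Main.v *)
Require Import Defs.
From mathcomp Require Import all_boot all_order all_algebra zify ring lra.
From mathcomp Require Import classical_sets reals sequences exp.

(* If q and r are primes with r > 2 sqrt x, r < q, and r divides p + q for primes
   p, q in (x, 2x], then p + q <= 4x < r^2, so P(p + q) = r and w(p q^2) = q r^2.
   It thus suffices to find r of size sqrt x log x and q in (x, 2x] such that the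
   class of -q modulo r contains its fair share of the primes P of (x, 2x].

   Let Z = #P and let V_r be the variance of P over the classes modulo r.  The
   number of pairs (p, q) in P^2 with r | p + q is at least Z^2/r - V_r, so one
   needs an r with V_r <= Z^2/(2r).  This is a large sieve with enough room for an
   elementary proof: with phi_r(n) = #{p in P : p = n mod r} - Z/r, one has
   sum_r V_r = sum_(p in P) sum_r phi_r(p); apply Cauchy-Schwarz, replace the
   indicator of P by the weight #{(i, j) : i < A, j < B, i + j = n} / B and
   expand the square.  For r <> s the function phi_r phi_s has period r s and mean
   zero (Chinese remainder theorem), so its weighted sum is O(r s Z^2 / B), and
   B of size x (log x)^5 makes these cross terms negligible.

   The lower bounds of Chebyshev type for primes in (y, 2y] come from the
   factorization of the central binomial coefficient, as in Erdos's proof of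
   Bertrand's postulate. *)

Set Implicit Arguments.
Unset Strict Implicit.
Unset Printing Implicit Defensive.

(** * Primes between n and 2n *)

Lemma dvdn_prod_primes (s : seq nat) m :
  uniq s -> {in s, forall p, prime p && (p %| m)} -> \prod_(p <- s) p %| m.
Proof.
elim: s => [|p s IHs] /=; first by rewrite big_nil dvd1n.
move=> /andP[ps us] sP; rewrite big_cons.
have /andP[pp pm] := sP p (mem_head p s).
have sP' : {in s, forall q, prime q && (q %| m)}.
  by move=> q qs; apply: sP; rewrite inE qs orbT.
rewrite Gauss_dvd; first by rewrite pm IHs.
rewrite big_seq; apply: (big_ind (coprime p)) => [|a b pa pb|q qs].
- exact: coprimen1.
- by rewrite coprimeMr pa pb.
- have /andP[pq _] := sP' q qs.
  by rewrite prime_coprime // dvdn_prime2 //; apply: contraNneq ps => ->.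
Qed.

(** The two equal middle coefficients of row 2m+1 both occur in the expansion of (1+1)^(2m+1). *)
Lemma bin_mid_le m : 'C(m.*2.+1, m) <= 4 ^ m.
Proof.
have /= := expnDn 1 1 m.*2.+1.
under eq_bigr do rewrite !exp1n !muln1.
have mlt : m < m.*2.+2 by lia.
have mlt1 : m.+1 < m.*2.+2 by lia.
rewrite (bigD1 (Ordinal mlt)) //= (bigD1 (Ordinal mlt1)) /=; last first.
  by rewrite -val_eqE /=; lia.
have -> : 'C(m.*2.+1, m.+1) = 'C(m.*2.+1, m).
  by rewrite -[LHS]bin_sub; [congr 'C(_, _)|]; lia.
move: (\sum_(_ < _ | _) _) => k.
by rewrite -[(1 + 1)%N]/2 expnS -mul2n expnM -[2 ^ 2]/4; lia.
Qed.

(** Strong induction. An even n > 2 adds no prime. For n = 2m+1, the primes in (m+1, 2m+1] divide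
    (2m+1)! but neither m! nor (m+1)!, so their product divides C(2m+1, m) <= 4^m; induction bounds
    the others by 4^(m+1). *)
Lemma primorial_le n : \prod_(0 <= p < n.+1 | prime p) p <= 4 ^ n.
Proof.
have [k] := ubnP n; elim: k n => // k IHk n /ltnSE nk.
have [n2|n2] := leqP n 2.
  by case: n n2 {nk} => [|[|[|//]]] _; rewrite unlock.
have [od|ev] := boolP (odd n); last first.
  rewrite big_mkcond big_nat_recr //= -big_mkcond /=.
  have -> : prime n = false.
    by apply/negP => /even_prime[n2'|]; [rewrite n2' in n2|rewrite (negPf ev)].
  case: n n2 nk {ev} => // n n2 nk; rewrite muln1.
  by apply: leq_trans (IHk n nk) _; rewrite leq_exp2l.
have nE : n = (n./2).*2.+1 by lia.
set m := n./2 in nE *.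
rewrite (big_cat_nat (n := m.+2)) //=; last by lia.
have -> : 4 ^ n = 4 ^ m.+1 * 4 ^ m by rewrite -expnD; congr (_ ^ _); lia.
apply: leq_mul; first by apply: IHk; lia.
apply: leq_trans (bin_mid_le m); apply: dvdn_leq; first by rewrite bin_gt0; lia.
rewrite -big_filter; apply: dvdn_prod_primes.
  by rewrite filter_uniq // iota_uniq.
move=> p; rewrite mem_filter mem_index_iota => /andP[pp pr]; rewrite pp /=.
have : p %| (m.*2.+1)`! by rewrite dvdn_fact // prime_gt0 //=; lia.
rewrite -(@bin_fact _ m); last by lia.
rewrite Euclid_dvdM // => /orP[//|]; rewrite Euclid_dvdM //.
have nd k' : k' < p -> p %| k'`! = false.
  move=> kp; apply/negbTE; elim: k' kp => [|k' IH] kp.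
    by rewrite fact0 dvdn1; have := prime_gt1 pp; lia.
  rewrite factS Euclid_dvdM // negb_or IH ?(ltnW kp) // andbT.
  by apply/negP => /dvdn_leq; lia.
by rewrite !nd //; lia.
Qed.

Lemma central_bin_ge n : 0 < n -> 4 ^ n <= n.*2 * 'C(n.*2, n).
Proof.
elim: n => // n IHn _.
have [->|n0] := posnP n; first by [].
have H1 : n.+1 * 'C(n.+1.*2, n.+1) = (n.*2.+2) * 'C(n.*2.+1, n).
  by rewrite -mul_bin_diag doubleS.
have H2 : n.*2.+1 * 'C(n.*2, n) = n.+1 * 'C(n.*2.+1, n).
  by rewrite (mul_bin_down n.*2.+1 n); congr (_ * _); lia.
have := IHn n0; rewrite expnS; nia.
Qed.

(** Legendre's formula for the three factorials. Cutting the sum at the last power of p not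
    exceeding 2n matters: each term is at most 1, so the p-part of C(2n, n) is at most 2n. *)
Lemma logn_central_bin n p : prime p ->
  logn p 'C(n.*2, n) =
  \sum_(1 <= k < (trunc_log p n.*2).+1) (n.*2 %/ p ^ k - (n %/ p ^ k).*2).
Proof.
move=> pp; have p1 := prime_gt1 pp.
have le2 k : (n %/ p ^ k).*2 <= n.*2 %/ p ^ k.
  by rewrite leq_divRL ?expn_gt0 ?prime_gt0 // -doubleMl leq_double leq_trunc_div.
have logE : logn p 'C(n.*2, n) =
    \sum_(1 <= k < n.*2.+1) (n.*2 %/ p ^ k - (n %/ p ^ k).*2).
  have nn : n <= n.*2 by lia.
  have := congr1 (logn p) (bin_fact nn).
  have -> : n.*2 - n = n by lia.
  rewrite !lognM ?muln_gt0 ?fact_gt0 ?bin_gt0 // !logn_fact //.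
  have -> : \sum_(1 <= k < n.+1) n %/ p ^ k = \sum_(1 <= k < n.*2.+1) n %/ p ^ k.
    rewrite [RHS](big_cat_nat (n := n.+1)) //=.
    rewrite [X in _ = _ + X]big_nat_cond [X in _ = _ + X]big1 ?addn0 // => k.
    rewrite andbT => /andP[nk _]; rewrite divn_small //.
    by apply: ltn_trans (ltn_expl k p1); lia.
  rewrite -big_split /= => E.
  apply/eqP; rewrite -(eqn_add2r (\sum_(1 <= k < n.*2.+1) (n %/ p ^ k + n %/ p ^ k))).
  rewrite E -big_split /=; apply/eqP; apply: eq_bigr => k _.
  by rewrite addnn subnK.
rewrite logE; have [->|n0] := posnP n; first by rewrite trunc_log0 !big_geq.
rewrite [LHS](big_cat_nat (n := (trunc_log p n.*2).+1)) //=; last first.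
  rewrite ltnS; apply: leq_trans (trunc_logP p1 _); last by lia.
  exact: ltnW (ltn_expl _ p1).
rewrite [X in _ + X]big_nat_cond [X in _ + X]big1 ?addn0 // => k.
rewrite andbT => /andP[nk _]; rewrite [_ %/ _]divn_small //.
by apply: leq_trans (trunc_log_ltn _ p1) _; rewrite leq_exp2l.
Qed.

Lemma double_div_le1 n d : n.*2 %/ d - (n %/ d).*2 <= 1.
Proof.
have [->|d0] := posnP d; first by rewrite !divn0.
by rewrite leq_subLR addnC -ltnS ltn_divLR // {1}(divn_eq n d); have := ltn_pmod n d0; nia.
Qed.

Lemma prod_const_if_le c m (P : pred nat) (s : seq nat) : 0 < c ->
  (forall i, i < m -> P i -> i \in s) ->
  \prod_(0 <= i < m) (if P i then c else 1) <= c ^ size s.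
Proof.
move=> c0 Ps; rewrite -big_mkcond big_const_seq iter_muln_1 leq_pexp2l //.
rewrite -size_filter; apply: uniq_leq_size => [|i].
  by rewrite filter_uniq // iota_uniq.
by rewrite mem_filter mem_index_iota => /andP[Pi /Ps]; apply.
Qed.

(** One factor per range of primes: p <= s contributes at most 2n; p > s has exponent at most 1, so
    those up to 2n/3 are bounded by the primorial; those in (2n/3, n] do not occur; each in (n, 2n]
    is at most 2n. *)
Lemma central_bin_le n s : 4 < n -> n.*2 < s.+1 ^ 2 ->
  'C(n.*2, n) <= n.*2 ^ s * 4 ^ (n.*2 %/ 3) *
                 n.*2 ^ size [seq p <- iota n.+1 n | prime p].
Proof.
move=> n4 ns; have C0 : 0 < 'C(n.*2, n) by rewrite bin_gt0; lia.
have CE : 'C(n.*2, n) = \prod_(0 <= p < n.*2.+1) p ^ logn p 'C(n.*2, n).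
  have log0 p : n.*2 < p -> logn p 'C(n.*2, n) = 0.
    have [pp|/negPf np] := boolP (prime p); last by rewrite /logn np.
    by move=> np; rewrite logn_central_bin // (@trunc_log_eq p 0) ?big_geq //=; lia.
  rewrite -{1}(partnT C0) /partn.
  rewrite (eq_bigl predT) //.
  (* The product given by [partnT] stops at the binomial coefficient instead of [n.*2]; whichever is
     larger, the factors beyond the smaller one equal 1. *)
  have /orP[le|le] := leq_total n.*2 'C(n.*2, n).
    rewrite (big_cat_nat (n := n.*2.+1)) //= [X in _ * X]big_nat_cond.
    rewrite [X in _ * X]big1 ?muln1 // => p; rewrite andbT => /andP[np _].
    by rewrite log0.
  rewrite [RHS](big_cat_nat (n := 'C(n.*2, n).+1)) //= [X in _ = _ * X]big_nat_cond.
  rewrite [X in _ = _ * X]big1 ?muln1 // => p; rewrite andbT => /andP[np _].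
  by rewrite ltn_log0.
pose f1 p := if (0 < p) && (p < s.+1) then n.*2 else 1.
pose f2 p := if prime p && (p < (n.*2 %/ 3).+1) then p else 1.
pose f3 p := if prime p && (n < p) then n.*2 else 1.
have fle p : p < n.*2.+1 -> p ^ logn p 'C(n.*2, n) <= f1 p * f2 p * f3 p.
  move=> pn.
  have f10 : 0 < f1 p by rewrite /f1; case: ifP; lia.
  have f20 : 0 < f2 p by rewrite /f2; case: ifP => // /andP[/prime_gt0].
  have f30 : 0 < f3 p by rewrite /f3; case: ifP; lia.
  have [pp|/negPf np] := boolP (prime p); last first.
    by rewrite /logn np expn0 !muln_gt0 f10 f20.
  have p1 := prime_gt1 pp.
  have le_tl : logn p 'C(n.*2, n) <= trunc_log p n.*2.
    rewrite logn_central_bin //.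
    apply: leq_trans (_ : \sum_(1 <= k < (trunc_log p n.*2).+1) 1 <= _).
      by apply: leq_sum => k _; exact: double_div_le1.
    by rewrite sum_nat_const_nat muln1 subn1.
  have [ps|ps] := ltnP p s.+1.
    have -> : f1 p = n.*2 by rewrite /f1 ps prime_gt0.
    rewrite -mulnA; apply: leq_trans (_ : n.*2 <= _); last first.
      by rewrite -{1}(muln1 n.*2) leq_mul2l muln_gt0 f20 f30 orbT.
    apply: leq_trans (trunc_logP p1 _); last by lia.
    by rewrite leq_exp2l.
  have tl1 : trunc_log p n.*2 = 1.
    apply: trunc_log_eq => //; rewrite expn1; apply/andP; split; first by lia.
    by apply: leq_trans ns _; rewrite leq_exp2r.
  have l1 : logn p 'C(n.*2, n) <= 1 by rewrite -tl1.
  have lp : p ^ logn p 'C(n.*2, n) <= p.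
    by rewrite -[leqRHS]expn1 leq_exp2l.
  have [pn'|np] := leqP p n; last first.
    have -> : f3 p = n.*2 by rewrite /f3 np pp.
    by apply: leq_trans lp _; rewrite -ltnS; apply: leq_trans pn _;
       rewrite ltnS leq_pmull // muln_gt0 f10 f20.
  have [p3|p3] := ltnP p (n.*2 %/ 3).+1.
    have -> : f2 p = p by rewrite /f2 p3 pp.
    apply: leq_trans lp _; rewrite mulnAC leq_pmull // muln_gt0 f10 f30 //.
  (* For 2n/3 < p <= n the quotient of n by p is 1 and that of 2n is 2, so the single term of the
     exponent vanishes. *)
  rewrite (_ : logn _ _ = 0) ?expn0 ?muln_gt0 ?f10 ?f20 //.
  rewrite logn_central_bin // tl1 big_nat1 expn1.
  have p3' : n.*2 < p * 3 by rewrite mulnC; move: p3; rewrite ltn_divLR //; lia.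
  have -> : n %/ p = 1 by apply/eqP; rewrite eqn_leq -ltnS ltn_divLR ?leq_divRL; lia.
  have : n.*2 %/ p < 3 by rewrite ltn_divLR; lia.
  by lia.
rewrite [X in X <= _]CE.
apply: leq_trans (_ : \prod_(0 <= p < n.*2.+1) (f1 p * f2 p * f3 p) <= _).
  rewrite !big_mkord; apply: leq_prod => i _; exact: fle.
rewrite !big_split /=; apply: leq_mul; first apply: leq_mul.
- rewrite -[X in _ ^ X](size_iota 1 s); apply: prod_const_if_le; first by lia.
  by move=> p _ /andP[p0 ps]; rewrite mem_iota; lia.
- apply: leq_trans (primorial_le _); rewrite /f2 -big_mkcond /=.
  rewrite (big_cat_nat (n := (n.*2 %/ 3).+1)) //=; last by rewrite ltnS leq_div.
  rewrite [X in _ * X]big_nat_cond [X in _ * X]big1 ?muln1; last by move=> p; lia.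
  rewrite big_nat_cond [leqRHS]big_nat_cond; apply/eq_leq/eq_bigl => p; lia.
- apply: prod_const_if_le; first by lia.
  by move=> p pn /andP[pp np]; rewrite mem_filter mem_iota pp; lia.
Qed.

Import Order.TTheory GRing.Theory Num.Theory.
Local Open Scope ring_scope.

(** * An elementary large sieve *)

Lemma sum_periodic_shift (V : zmodType) (f : nat -> V) Q k :
  (forall n, f (n + Q)%N = f n) -> \sum_(i < Q) f (k + i)%N = \sum_(i < Q) f i.
Proof.
move=> fQ; elim: k => // k <-; case: Q fQ => [|Q] fQ; first by rewrite !big_ord0.
rewrite big_ord_recr [RHS]big_ord_recl /= addrC addSnnS fQ addn0; congr (_ + _).
by apply: eq_bigr => i _; rewrite addSnnS.
Qed.

Lemma sum_periodic_mod (V : zmodType) (f : nat -> V) Q n :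
  (forall n, f (n + Q)%N = f n) ->
  \sum_(i < n) f i = (\sum_(i < Q) f i) *+ (n %/ Q) + \sum_(i < n %% Q) f i.
Proof.
move=> fQ; suff H k m : \sum_(i < k * Q + m) f i =
    (\sum_(i < Q) f i) *+ k + \sum_(i < m) f i by rewrite -H -divn_eq.
elim: k => [|k IHk].
  by rewrite mul0n add0n mulr0n add0r.
rewrite mulSn -addnA big_split_ord /= mulrS -addrA -IHk; congr (_ + _).
by apply: eq_bigr => i _; rewrite addnC fQ.
Qed.

Lemma ler_sum_ord_widen (R : realFieldType) (f : nat -> R) m n :
  (forall i, 0 <= f i) -> (m <= n)%N -> \sum_(i < m) f i <= \sum_(i < n) f i.
Proof.
move=> f0 /subnKC <-; rewrite big_split_ord /= lerDl; exact: sumr_ge0.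
Qed.

Lemma sum_periodic_le (R : realFieldType) (f : nat -> R) Q n :
  (0 < Q)%N -> (forall i, 0 <= f i) -> (forall n, f (n + Q)%N = f n) ->
  \sum_(i < n) f i <= ((n %/ Q).+1)%:R * \sum_(i < Q) f i.
Proof.
move=> Q0 f0 fQ; rewrite (sum_periodic_mod n fQ) mulr_natl mulrSr lerD2l.
exact: ler_sum_ord_widen (ltnW (ltn_pmod _ _)).
Qed.

(** Complete periods cancel, which leaves fewer than [Q] terms. *)
Lemma norm_sum_periodic_le (R : realFieldType) (f : nat -> R) Q n :
  (0 < Q)%N -> (forall n, f (n + Q)%N = f n) -> \sum_(i < Q) f i = 0 ->
  `|\sum_(i < n) f i| <= \sum_(i < Q) `|f i|.
Proof.
move=> Q0 fQ s0; rewrite (sum_periodic_mod n fQ) s0 mul0rn add0r.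
apply: le_trans (ler_norm_sum _ _ _) _.
exact: (@ler_sum_ord_widen _ (fun i => `|f i|)) (ltnW (ltn_pmod _ _)).
Qed.

(* Summing twice is what makes the bound independent of the number of periods
   contained in the range of [j]. *)
Lemma norm_box_sum_periodic_le (R : realFieldType) (f : nat -> R) Q A B :
  (0 < Q)%N -> (forall n, f (n + Q)%N = f n) -> \sum_(i < Q) f i = 0 ->
  `|\sum_(i < A) \sum_(j < B) f (i + j)%N| <= Q%:R * \sum_(i < Q) `|f i|.
Proof.
(* The inner sum [G] is again periodic with mean zero, so the one-dimensional bound applies first in
   [i], then in [j] inside each of the [Q] remaining terms. *)
move=> Q0 fQ s0; pose G i := \sum_(j < B) f (i + j)%N.
have GQ n : G (n + Q)%N = G n by apply: eq_bigr => j _; rewrite addnAC fQ.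
have G0 : \sum_(i < Q) G i = 0.
  rewrite exchange_big big1 //= => j _; rewrite -[RHS]s0 -(sum_periodic_shift j fQ).
  by apply: eq_bigr => i _; rewrite addnC.
apply: le_trans (norm_sum_periodic_le A Q0 GQ G0) _.
rewrite mulr_natl -[X in _ *+ X](card_ord Q) -sumr_const; apply: ler_sum => i _.
have fQi n : f (i + (n + Q))%N = f (i + n)%N by rewrite addnA fQ.
apply: le_trans (norm_sum_periodic_le (f := fun j => f (i + j)%N) B Q0 fQi _) _.
  by rewrite (sum_periodic_shift i fQ).
by rewrite (sum_periodic_shift i (f := fun j => `|f j|)) // => n; rewrite fQ.
Qed.

Lemma sum_crt (R : comPzRingType) (g h : nat -> R) r s :
  (0 < r)%N -> (0 < s)%N -> coprime r s ->
  \sum_(m < r * s) g (m %% r)%N * h (m %% s)%N =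
  (\sum_(a < r) g a) * (\sum_(b < s) h b).
Proof.
move=> r0 s0 rs; rewrite big_distrlr pair_big /=.
pose u (m : 'I_(r * s)) := (Ordinal (ltn_pmod m r0), Ordinal (ltn_pmod m s0)).
have u_inj : injective u.
  move=> m n [/eqP mr /eqP ms]; apply: val_inj => /=.
  have : m == n %[mod r * s] by rewrite chinese_remainder // mr ms.
  by rewrite !modn_small // => /eqP.
by rewrite (reindex u) //=; apply/onW_bij/inj_card_bij => //; rewrite card_prod !card_ord.
Qed.

(** Cauchy-Schwarz against the constant 1, by expanding the non-negative double sum of the squares
    (F i - F j)^2. *)
Lemma sqr_sum_le (R : realFieldType) (I : Type) (s : seq I) (F : I -> R) :
  (\sum_(i <- s) F i) ^+ 2 <= (size s)%:R * \sum_(i <- s) F i ^+ 2.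
Proof.
have : 0 <= \sum_(i <- s) \sum_(j <- s) (F i - F j) ^+ 2.
  by do 2![apply: sumr_ge0 => ? _]; exact: sqr_ge0.
have -> : \sum_(i <- s) \sum_(j <- s) (F i - F j) ^+ 2 =
    2 * ((size s)%:R * (\sum_(i <- s) F i ^+ 2) - (\sum_(i <- s) F i) ^+ 2).
  set S1 := \sum_(i <- s) F i; set S2 := \sum_(i <- s) F i ^+ 2.
  have inner i : \sum_(j <- s) (F i - F j) ^+ 2 =
      (size s)%:R * F i ^+ 2 + (- (2 * S1) * F i + S2).
    rewrite (eq_bigr (fun j => F i ^+ 2 + (- (2 * F i) * F j + F j ^+ 2))).
      rewrite !big_split /= big_const_seq count_predT iter_addr_0 -mulr_sumr.
      by rewrite -mulr_natl -/S1 -/S2; ring.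
    by move=> j _; ring.
  rewrite (eq_bigr _ (fun i _ => inner i)) !big_split /= big_const_seq count_predT.
  by rewrite iter_addr_0 -!mulr_sumr -mulr_natl -/S1 -/S2; ring.
by rewrite pmulr_rge0 // subr_ge0.
Qed.

Lemma ler_sum_sub_uniq (R : realFieldType) (I : eqType) (s t : seq I) (g : I -> R) :
  (forall i, 0 <= g i) -> uniq s -> uniq t -> {subset s <= t} ->
  \sum_(i <- s) g i <= \sum_(i <- t) g i.
Proof.
move=> g0 us ut st; rewrite [leRHS](bigID (mem s)) /= -[X in _ <= X + _]big_filter.
rewrite [X in _ <= X + _](perm_big s) /=; first by rewrite lerDl; apply: sumr_ge0.
apply: uniq_perm; rewrite ?filter_uniq // => i.
by rewrite mem_filter /=; case: (boolP (i \in s)) => //= /st ->.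
Qed.

(** * Deviation and variance over residue classes *)

Definition residue_count (P : seq nat) (r a : nat) : nat :=
  count (fun p => p == a %[mod r]) P.

(** The function phi_r of the overview; subtracting the mean makes it sum to zero over a period. *)
Definition deviation (R : realFieldType) (P : seq nat) (r a : nat) : R :=
  (residue_count P r a)%:R - (size P)%:R / r%:R.

Definition variance (R : realFieldType) (P : seq nat) (r : nat) : R :=
  \sum_(a < r) deviation R P r a ^+ 2.

Lemma residue_count_mod P r a : residue_count P r (a %% r) = residue_count P r a.
Proof. by apply: eq_count => p; rewrite modn_mod. Qed.

Lemma deviation_mod (R : realFieldType) P r a :
  deviation R P r (a %% r) = deviation R P r a.
Proof. by rewrite /deviation residue_count_mod. Qed.

Lemma deviation_periodic (R : realFieldType) P r a :
  deviation R P r (a + r) = deviation R P r a.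
Proof. by rewrite -deviation_mod modnDr deviation_mod. Qed.

Lemma sum_residue_count (R : realFieldType) (g : nat -> R) P r : (0 < r)%N ->
  \sum_(a < r) (residue_count P r a)%:R * g a = \sum_(p <- P) g (p %% r)%N.
Proof.
move=> r0; elim: P => [|p P IHP].
  by rewrite big_nil big1 // => a _; rewrite mul0r.
rewrite big_cons -IHP /residue_count /=.
under eq_bigr => a _ do rewrite natrD mulrDl.
rewrite big_split /=; congr (_ + _).
rewrite (bigD1 (Ordinal (ltn_pmod p r0))) //= modn_mod eqxx mul1r big1 ?addr0 //.
move=> a; rewrite -val_eqE /= => ap.
by rewrite [(a %% r)%N]modn_small // eq_sym (negPf ap) mul0r.
Qed.

Lemma sum_residue_count1 (R : realFieldType) P r : (0 < r)%N ->
  \sum_(a < r) (residue_count P r a)%:R = (size P)%:R :> R.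
Proof.
move=> r0; have := sum_residue_count (fun=> 1 : R) P r0.
by under eq_bigr do rewrite mulr1; rewrite big_const_seq count_predT iter_addr_0.
Qed.

Lemma sum_deviation (R : realFieldType) P r : (0 < r)%N ->
  \sum_(a < r) deviation R P r a = 0.
Proof.
move=> r0; rewrite big_split /= sum_residue_count1 // sumr_const card_ord.
by rewrite -[X in _ + X]mulr_natr mulNr divfK ?subrr // pnatr_eq0 -lt0n.
Qed.

Lemma sum_norm_deviation (R : realFieldType) P r : (0 < r)%N ->
  \sum_(a < r) `|deviation R P r a| <= 2 * (size P)%:R.
Proof.
move=> r0; have r0' : r%:R != 0 :> R by rewrite pnatr_eq0 -lt0n.
apply: le_trans (_ : \sum_(a < r) ((residue_count P r a)%:R + (size P)%:R / r%:R) <= _).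
  apply: ler_sum => a _; apply: le_trans (ler_normB _ _) _.
  by rewrite !ger0_norm ?divr_ge0.
rewrite big_split /= sum_residue_count1 // sumr_const card_ord.
by rewrite -[X in _ + X]mulr_natr divfK // mulr_natl mulr2n.
Qed.

(** Summing over [P] weights class a by its count, which is its deviation plus a constant; the
    constant drops out by mean zero. This makes the variance linear in phi_r, ready for
    Cauchy-Schwarz. *)
Lemma sum_deviation_seq (R : realFieldType) P r : (0 < r)%N ->
  \sum_(p <- P) deviation R P r p = variance R P r.
Proof.
move=> r0; under eq_bigr do rewrite -deviation_mod.
rewrite -(sum_residue_count (deviation R P r)) // /variance.
under [RHS]eq_bigr do rewrite expr2 {1}/deviation mulrBl.
by rewrite sumrB -mulr_sumr sum_deviation // mulr0 subr0.
Qed.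

(** In this form the variance depends only on congruences between elements of [P], hence is
    invariant under translation. *)
Lemma varianceE (R : realFieldType) P r : (0 < r)%N ->
  variance R P r =
  \sum_(p <- P) (residue_count P r p)%:R - (size P)%:R ^+ 2 / r%:R.
Proof.
move=> r0; rewrite -sum_deviation_seq // sumrB; congr (_ - _).
by rewrite big_const_seq count_predT iter_addr_0 -[(_ / _) *+ _]mulr_natl mulrA -expr2.
Qed.

Lemma variance_shift (R : realFieldType) P r B : (0 < r)%N ->
  variance R [seq (B + p)%N | p <- P] r = variance R P r.
Proof.
move=> r0; rewrite !varianceE // size_map big_map; congr (_ - _).
apply: eq_bigr => p _; rewrite /residue_count count_map; congr (_%:R).
by apply: eq_count => q /=; rewrite eqn_modDl.
Qed.

(** For each j, the range of i is covered by at most A/r + 1 periods, each contributing the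
    variance; [L] replaces [r] to make the bound uniform in r. *)
Lemma box_deviation_diag (R : realFieldType) P r A B L :
  (0 < L <= r)%N ->
  \sum_(i < A) \sum_(j < B) deviation R P r (i + j) ^+ 2 <=
  B%:R * (A%:R / L%:R + 1) * variance R P r.
Proof.
move=> /andP[L0 Lr]; have r0 := leq_trans L0 Lr.
rewrite exchange_big /= -mulrA mulr_natl -[X in _ *+ X](card_ord B) -sumr_const.
apply: ler_sum => j _; pose f i := deviation R P r (i + j) ^+ 2.
have fr n : f (n + r)%N = f n by rewrite /f addnAC deviation_periodic.
have f0 n : 0 <= f n by exact: sqr_ge0.
apply: le_trans (sum_periodic_le A r0 f0 fr) _.
have -> : \sum_(i < r) f i = variance R P r.
  rewrite /variance -(sum_periodic_shift j (f := fun a => deviation R P r a ^+ 2)).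
    by apply: eq_bigr => i _; rewrite addnC.
  by move=> n; rewrite deviation_periodic.
apply: ler_wpM2r; first by apply: sumr_ge0 => a _; exact: sqr_ge0.
rewrite -natr1 lerD2r ler_pdivlMr ?ltr0n // -natrM ler_nat.
by apply: leq_trans (leq_trunc_div A r); rewrite leq_mul2l Lr orbT.
Qed.

Lemma box_deviation_cross (R : realFieldType) P r s A B H :
  (0 < r <= H)%N -> (0 < s <= H)%N -> coprime r s ->
  \sum_(i < A) \sum_(j < B) deviation R P r (i + j) * deviation R P s (i + j) <=
  H%:R ^+ 2 * (2 * (size P)%:R) ^+ 2.
Proof.
move=> /andP[r0 rH] /andP[s0 sH] rs.
pose f n := deviation R P r n * deviation R P s n.
have fE n : f n = deviation R P r (n %% r) * deviation R P s (n %% s).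
  by rewrite !deviation_mod.
have frs n : f (n + r * s)%N = f n.
  by rewrite !fE {1}mulnC ![(n + _)%N]addnC !modnMDl.
have f0 : \sum_(i < r * s) f i = 0.
  under eq_bigr do rewrite fE.
  by rewrite (sum_crt _ _ r0 s0 rs) sum_deviation // mul0r.
have rs0 : (0 < r * s)%N by rewrite muln_gt0 r0.
apply: le_trans (ler_norm _) _.
apply: le_trans (norm_box_sum_periodic_le A B rs0 frs f0) _.
under eq_bigr do rewrite fE normrM.
rewrite (sum_crt (fun a => `|deviation R P r a|) (fun a => `|deviation R P s a|) r0 s0 rs).
apply: ler_pM; rewrite ?mulr_ge0 ?sumr_ge0 //.
  by rewrite natrM expr2 ler_pM // ler_nat.
by rewrite expr2 ler_pM ?sumr_ge0 // sum_norm_deviation.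
Qed.

Lemma sum_variance_sqr_le (R : realFieldType) (P S : seq nat) A B L H :
  uniq P -> {in P, forall p, B <= p < A}%N ->
  uniq S -> {in S, forall r, prime r /\ (L <= r <= H)%N} -> (0 < L)%N ->
  B%:R * (\sum_(r <- S) variance R P r) ^+ 2 <=
  (size P)%:R * (B%:R * (A%:R / L%:R + 1) * (\sum_(r <- S) variance R P r)
     + (size S)%:R ^+ 2 * (H%:R ^+ 2 * (2 * (size P)%:R) ^+ 2)).
Proof.
move=> uP Pb uS Sb L0; pose F n := \sum_(r <- S) deviation R P r n.
have Sr r : r \in S -> [/\ prime r, (0 < L <= r)%N & (0 < r <= H)%N].
  by move=> /Sb[pr /andP[Lr rH]]; rewrite L0 Lr rH prime_gt0.
have -> : \sum_(r <- S) variance R P r = \sum_(p <- P) F p.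
  rewrite exchange_big /= big_seq [RHS]big_seq; apply: eq_bigr => r /Sr[pr _ _].
  by rewrite sum_deviation_seq // prime_gt0.
set U := \sum_(p <- P) F p.
apply: le_trans (_ : (size P)%:R * (B%:R * \sum_(p <- P) F p ^+ 2) <= _).
  by rewrite [leRHS]mulrCA ler_wpM2l // sqr_sum_le.
apply: ler_wpM2l => //.
(* As B <= p < A, the difference p - j lies in [0, A) for each j < B, so every p in [P] is
   represented exactly [B] times; the other terms are squares and only enlarge the sum. *)
apply: le_trans (_ : \sum_(i < A) \sum_(j < B) F (i + j)%N ^+ 2 <= _).
  rewrite mulr_natl -[X in _ *+ X](card_ord B) -sumr_const [leRHS]exchange_big /=.
  apply: ler_sum => j _; rewrite -(big_mkord xpredT (fun i => F (i + j)%N ^+ 2)).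
  rewrite -{1}(addnK j A) -{1}(add0n j) -(big_addn _ _ _ xpredT (fun i => F i ^+ 2)).
  apply: ler_sum_sub_uniq => // [i||p /Pb]; rewrite ?iota_uniq ?sqr_ge0 //.
  by rewrite mem_index_iota; have := ltn_ord j; lia.
under eq_bigr => i _.
  under eq_bigr => j _ do rewrite expr2 big_distrlr /=.
  rewrite exchange_big /=; under eq_bigr => r _ do rewrite exchange_big /=.
  over.
rewrite exchange_big /=; under eq_bigr => r _ do rewrite exchange_big /=.
set c := H%:R ^+ 2 * _; set d := _ * (_ + 1).
apply: le_trans (_ : \sum_(r <- S) (d * variance R P r + (size S)%:R * c) <= _).
  (* For fixed r, the term s = r is the diagonal one and each other s contributes at most [c]. *)
  rewrite big_seq [leRHS]big_seq; apply: ler_sum => r rS.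
  have [pr Lr rH] := Sr r rS.
  have c0 : 0 <= c by rewrite mulr_ge0 ?sqr_ge0.
  rewrite (bigD1_seq r) //= lerD //.
    by under eq_bigr do under eq_bigr do rewrite -expr2; exact: box_deviation_diag.
  apply: le_trans (_ : \sum_(s <- S) c <= _); last first.
    by rewrite big_const_seq count_predT iter_addr_0 mulr_natl.
  rewrite big_mkcond big_seq [leRHS]big_seq; apply: ler_sum => s sS.
  have [ps Ls sH] := Sr s sS.
  case: ifP => // sr; apply: box_deviation_cross => //.
  by rewrite prime_coprime // dvdn_prime2 // eq_sym sr.
rewrite big_split /= -mulr_sumr big_const_seq count_predT iter_addr_0.
rewrite -[(_ * c) *+ _]mulr_natl mulrA -expr2 lerD2r ler_wpM2l //.
  by rewrite mulr_ge0 // addr_ge0 // divr_ge0.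
rewrite /U /F [leRHS]exchange_big /= big_seq [leRHS]big_seq.
by apply: ler_sum => r /Sr[pr _ _]; rewrite sum_deviation_seq // prime_gt0.
Qed.

(** The sum of counts differs from its expected value Z^2/r by the correlation of phi_r(a) with
    phi_r(-a). Both have second moment V_r, so the correlation is at least -V_r because the sum of
    (phi_r(a) + phi_r(-a))^2 is non-negative. *)
Lemma sum_opposite_count_ge (R : realFieldType) P r : (0 < r)%N ->
  (size P)%:R ^+ 2 / r%:R - variance R P r <=
  \sum_(q <- P) (count (fun p => r %| p + q)%N P)%:R.
Proof.
move=> r0; pose psi a := deviation R P r (r - a %% r).
have sum_psi (g : R -> R) :
    \sum_(a < r) g (psi a) = \sum_(a < r) g (deviation R P r a).
  rewrite -(sum_periodic_shift 1 (f := fun a => g (deviation R P r a))); last first.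
    (* Here r - a = 1 + (r - 1 - a): negating the class is a reversal of [0, r) followed by a shift
       by one. *)
    by move=> n; rewrite deviation_periodic.
  rewrite [RHS](reindex_inj rev_ord_inj) /=; apply: eq_bigr => a _.
  by rewrite /psi modn_small //; congr (g (deviation R P r _)); have := ltn_ord a; lia.
have count_psi q : (count (fun p => r %| p + q)%N P)%:R =
    psi (q %% r)%N + (size P)%:R / r%:R.
  rewrite /psi /deviation subrK; congr (_%:R); apply: eq_count => p.
  rewrite modn_mod -(eqn_modDr (q %% r)) subnK ?(ltnW (ltn_pmod _ _)) //.
  by rewrite modnDmr modnn.
have corr : \sum_(a < r) deviation R P r a * psi a =
    \sum_(q <- P) (count (fun p => r %| p + q)%N P)%:R - (size P)%:R ^+ 2 / r%:R.
  under eq_bigr do rewrite {1}/deviation mulrBl.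
  rewrite sumrB -mulr_sumr (sum_psi id) sum_deviation // mulr0 subr0.
  rewrite sum_residue_count // (eq_bigr _ (fun q _ => count_psi q)) [X in _ = X - _]big_split /=.
  by rewrite big_const_seq count_predT iter_addr_0 -[(_ / _) *+ _]mulr_natl; ring.
have : 0 <= \sum_(a < r) (deviation R P r a + psi a) ^+ 2.
  by apply: sumr_ge0 => a _; exact: sqr_ge0.
have -> : \sum_(a < r) (deviation R P r a + psi a) ^+ 2 = variance R P r +
    (2 * (\sum_(a < r) deviation R P r a * psi a) + \sum_(a < r) psi a ^+ 2).
  by rewrite mulr_sumr -!big_split /=; apply: eq_bigr => a _; ring.
rewrite (sum_psi (fun y => y ^+ 2)) -/(variance R P r) corr; lra.
Qed.

(* Translating P by B puts it where all the weights of the double sum equal B. *)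
Lemma exists_small_variance (R : realFieldType) (P S : seq nat) N B L :
  uniq P -> {in P, forall p, p < N}%N ->
  uniq S -> {in S, forall r, prime r /\ (L <= r <= 2 * L)%N} -> (0 < L)%N ->
  (512 * L ^ 4 <= B * size P)%N -> (8 * (N + B + L) <= size S * size P)%N ->
  exists2 r, r \in S & variance R P r <= (size P)%:R ^+ 2 / (2 * r%:R).
Proof.
move=> uP PN uS Sb L0 cond1 cond2.
have [/hasP[r rS Vr]|/hasPn big_V] :=
  boolP (has (fun r => variance R P r <= (size P)%:R ^+ 2 / (2 * r%:R)) S).
  by exists r.
pose P' := [seq (B + p)%N | p <- P].
have uP' : uniq P' by rewrite map_inj_uniq // => p q /addnI.
have P'b : {in P', forall p, B <= p < N + B}%N.
  by move=> _ /mapP[p /PN pN ->]; lia.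
have := @sum_variance_sqr_le R _ _ _ _ _ _ uP' P'b uS Sb L0.
have VE : \sum_(r <- S) variance R P' r = \sum_(r <- S) variance R P r.
  rewrite big_seq [RHS]big_seq; apply: eq_bigr => r /Sb[pr _].
  by rewrite variance_shift // prime_gt0.
rewrite VE size_map => main.
set U := \sum_(r <- S) variance R P r in main.
have /andP[k0' z0'] : (0 < size S)%N && (0 < size P)%N by rewrite -muln_gt0; lia.
have b0' : (0 < B)%N.
  have : (0 < B * size P)%N by apply: leq_trans cond1; rewrite muln_gt0 expn_gt0 L0.
  by rewrite muln_gt0 => /andP[].
have l0 : 0 < L%:R :> R by rewrite ltr0n.
have k0 : 0 < (size S)%:R :> R by rewrite ltr0n.
have z0 : 0 < (size P)%:R :> R by rewrite ltr0n.
have b0 : 0 < B%:R :> R by rewrite ltr0n.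
move: cond1 cond2; rewrite -!(ler_nat R) (natrM _ 512) natrX !natrM !natrD.
move: main; rewrite !natrM natrD.
(* If every r fails, each variance exceeds Z^2/(2r), which is at least Z^2/(4L). *)
have uU : (size S)%:R * (size P)%:R ^+ 2 / (4 * L%:R) < U.
  apply: le_lt_trans (_ : \sum_(r <- S) (size P)%:R ^+ 2 / (4 * L%:R) < _).
    by rewrite big_const_seq count_predT iter_addr_0 -[(_ / _) *+ _]mulr_natl mulrA.
  rewrite /U big_seq [ltRHS]big_seq; apply: ltr_sum.
    by case: (S) k0' => //= r S' _; rewrite mem_head.
  move=> r rS; apply: le_lt_trans (_ : (size P)%:R ^+ 2 / (2 * r%:R) < _); last first.
    by rewrite ltNge big_V.
  have [/prime_gt0 r0 /andP[_ rL]] := Sb r rS.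
  rewrite ler_wpM2l ?sqr_ge0 // lef_pV2 ?posrE ?mulr_gt0 ?ltr0n //.
  by move: rL; rewrite -(ler_nat R) natrM; lra.
move: (size S)%:R (size P)%:R L%:R B%:R N%:R k0 z0 l0 b0 uU => k z l b n k0 z0 l0 b0.
set u := k * _ / _ => uU main c1 c2.
have u0 : 0 < u by rewrite divr_gt0 ?mulr_gt0 ?exprn_gt0.
(* The constant 8 makes the diagonal part at most bUu/2, and 512 makes the cross terms at most
   bu^2/2. Together they contradict U > u, since U^2 - Uu/2 - u^2/2 = (U - u)(U + u/2). *)
have h1 : z * ((n + b) / l + 1) <= u / 2.
  rewrite -(ler_pM2r l0) /u.
  have -> : z * ((n + b) / l + 1) * l = z * (n + b + l) by field; rewrite gt_eqF.
  have -> : k * z ^+ 2 / (4 * l) / 2 * l = z * (k * z) / 8 by field; rewrite gt_eqF.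
  nra.
have h2 : z * (k ^+ 2 * ((2 * l) ^+ 2 * (2 * z) ^+ 2)) <= b * u ^+ 2 / 2.
  have -> : b * u ^+ 2 / 2 = k ^+ 2 * z ^+ 3 / (32 * l ^+ 2) * (b * z).
    by rewrite /u; field; rewrite gt_eqF.
  apply: le_trans (_ : k ^+ 2 * z ^+ 3 / (32 * l ^+ 2) * (512 * l ^+ 4) <= _).
    by rewrite le_eqVlt; apply/orP; left; apply/eqP; field; rewrite gt_eqF.
  by rewrite ler_wpM2l // divr_ge0 ?mulr_ge0 ?exprn_ge0 ?ltW.
have U0 : 0 < U by apply: lt_trans uU.
have : b * U ^+ 2 < b * U ^+ 2; last by rewrite ltxx.
apply: le_lt_trans main _.
apply: le_lt_trans (_ : b * U * (u / 2) + b * u ^+ 2 / 2 < _).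
  rewrite mulrDr lerD //.
  have -> : z * (b * ((n + b) / l + 1) * U) = b * U * (z * ((n + b) / l + 1)) by ring.
  by rewrite ler_wpM2l // mulr_ge0 ?ltW.
rewrite -subr_gt0.
have -> : b * U ^+ 2 - (b * U * (u / 2) + b * u ^+ 2 / 2) =
    b * ((U - u) * (U + u / 2)) by field.
by apply: mulr_gt0 => //; apply: mulr_gt0; lra.
Qed.

(** With the variance at most Z^2/(2r), the counts sum to at least Z^2/(2r) over q in [P], so some q
    reaches the average Z/(2r). The claim concerns naturals only, so [rat] serves as the field. *)
Lemma exists_opposite_residue (P S : seq nat) N B L :
  uniq P -> {in P, forall p, p < N}%N ->
  uniq S -> {in S, forall r, prime r /\ (L <= r <= 2 * L)%N} -> (0 < L)%N ->
  (512 * L ^ 4 <= B * size P)%N -> (8 * (N + B + L) <= size S * size P)%N ->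
  exists r q, [/\ r \in S, q \in P &
    (size P <= 2 * r * count (fun p => r %| p + q) P)%N].
Proof.
move=> uP PN uS Sb L0 cond1 cond2.
have [r rS Vr] := exists_small_variance rat uP PN uS Sb L0 cond1 cond2.
have /andP[_ z0] : (0 < size S)%N && (0 < size P)%N by rewrite -muln_gt0; lia.
have [/hasP[q qP Hq]|/hasPn no_q] :=
  boolP (has (fun q => size P <= 2 * r * count (fun p => r %| p + q) P)%N P).
  by exists r, q.
have r0 : (0 < r)%N by have [/prime_gt0] := Sb r rS.
have r0' : r%:R != 0 :> rat by rewrite pnatr_eq0 -lt0n.
have := sum_opposite_count_ge rat P r0.
have : \sum_(q <- P) (count (fun p => r %| p + q)%N P)%:R <
    \sum_(q <- P) (size P)%:R / (2 * r%:R) :> rat.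
  rewrite big_seq [ltRHS]big_seq; apply: ltr_sum.
    by case: P z0 {uP PN cond1 cond2 Vr no_q} => //= p P _; rewrite mem_head.
  move=> q /no_q; rewrite -ltnNge -(ltr_nat rat) ltr_pdivlMr ?mulr_gt0 ?ltr0n //.
  by rewrite !natrM mulrC.
rewrite big_const_seq count_predT iter_addr_0 -[(_ / _) *+ _]mulr_natl.
have -> : (size P)%:R * ((size P)%:R / (2 * r%:R)) = (size P)%:R ^+ 2 / r%:R / 2 :> rat.
  by field.
move: Vr; have -> : (size P)%:R ^+ 2 / (2 * r%:R) = (size P)%:R ^+ 2 / r%:R / 2 :> rat.
  by field.
lra.
Qed.

(** * Parents, and the choice of the parameters *)

(** A larger prime factor would divide m together with r, forcing m >= r^2. *)
Lemma max_pdiv_large m r : prime r -> (r %| m)%N -> (0 < m < r ^ 2)%N ->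
  max_pdiv m = r.
Proof.
move=> pr rm /andP[m0 mr].
have rle : (r <= max_pdiv m)%N.
  by apply: max_pdiv_max; rewrite mem_primes pr m0.
have m1 : (1 < m)%N by apply: leq_trans (prime_gt1 pr) (dvdn_leq m0 rm).
apply/eqP; apply: contraTT mr => neq; rewrite -leqNgt.
apply: leq_trans (_ : r * max_pdiv m <= _)%N; first by rewrite expnS expn1 leq_mul2l rle orbT.
apply: dvdn_leq => //; rewrite Gauss_dvd ?rm ?max_pdiv_dvd //.
by rewrite prime_coprime // dvdn_prime2 ?max_pdiv_prime // eq_sym.
Qed.

Lemma B3_mul_sqr a b : prime a -> prime b -> a != b -> B3 (a * b ^ 2)%N.
Proof.
move=> pa pb ab; exists a, b, b; split; rewrite ?(negPf ab) ?eqxx //.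
by rewrite expnS expn1 mulnA.
Qed.

Lemma B3_parent_of_dvd p q r : prime p -> prime q -> prime r ->
  (2 < r < q)%N -> (r %| p + q)%N -> (p + q < r ^ 2)%N ->
  p <> q /\ B3_parent (q * r ^ 2)%N (p * q ^ 2)%N.
Proof.
move=> pp pq pr /andP[r2 rq] rpq pqr.
(* If p = q, then r divides 2q, impossible for a prime r strictly between 2 and the prime q. *)
have neq : p != q.
  apply: contraTneq rpq => ->; rewrite addnn -mul2n Euclid_dvdM // !dvdn_prime2 //.
  by rewrite negb_or; lia.
have Bn : B3 (q * r ^ 2)%N by apply: B3_mul_sqr => //; lia.
have Bm : B3 (p * q ^ 2)%N by exact: B3_mul_sqr.
split; [exact/eqP|split=> //; split; [by right|by right|]].
rewrite -mulnn mulnA wE // (max_pdiv_large pr rpq) ?pqr ?addn_gt0 ?prime_gt0 //.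
(* The third factor of [w] is P(2q) = q, as 2q < q^2. *)
rewrite (@max_pdiv_large (q + q) q) ?dvdn_addr //; last by have := prime_gt0 pq; nia.
by rewrite -mulnn mulnC.
Qed.

(** With t = ln y, the root is exp(t/2), which dominates the term of degree k+1 of its series; the
    extra power of t absorbs [K]. *)
Lemma ln_pow_le_sqrt (R : realType) (K : R) k :
  exists y0 : R, forall y, y0 <= y -> K * ln y ^+ k <= Num.sqrt y.
Proof.
pose M := Num.max 1 (K * (2 ^+ k.+1 * k.+1`!%:R)).
exists (expR M) => y My; have y0 : 0 < y by apply: lt_le_trans My; exact: expR_gt0.
set t := ln y; have yE : y = expR t by rewrite lnK.
have Mt : M <= t by rewrite -ler_expR -yE.
have t1 : 1 <= t by apply: le_trans Mt; rewrite le_max lexx.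
have Kt : K * (2 ^+ k.+1 * k.+1`!%:R) <= t.
  by apply: le_trans Mt; rewrite le_max lexx orbT.
have -> : Num.sqrt y = expR (t / 2).
  by rewrite yE {1}(splitr t) expRD -expr2 sqrtr_sqr ger0_norm ?expR_ge0.
have t2 : 0 <= t / 2 by lra.
apply: le_trans (_ : (t / 2) ^+ k.+1 / k.+1`!%:R <= _); last first.
  by have := expR_ge1Dxn k t2; lra.
have d0 : 0 < 2 ^+ k.+1 * k.+1`!%:R :> R.
  by rewrite mulr_gt0 ?exprn_gt0 // ltr0n fact_gt0.
have -> : (t / 2) ^+ k.+1 / k.+1`!%:R = t ^+ k.+1 / (2 ^+ k.+1 * k.+1`!%:R) :> R.
  by rewrite expr_div_n -mulrA -invfM.
rewrite ler_pdivlMr // mulrAC [leRHS]exprSr mulrC; apply: ler_wpM2l => //.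
by rewrite exprn_ge0 //; lra.
Qed.

(** Logarithms of 4^n <= 2n C(2n, n) <= (2n)^(1+s+Z) 4^(2n/3), with s the integer part of sqrt(2n).
    What remains on the left is 4^(n/3), and ln 4 >= 1. *)
Lemma prime_count_ge (R : realType) (n : nat) : (4 < n)%N ->
  n%:R / 3 <= ((size [seq p <- iota n.+1 n | prime p])%:R
               + Num.sqrt (2 * n%:R) + 1) * ln (2 * n%:R) :> R.
Proof.
move=> n4; set Z := size _; pose s := Num.truncn (Num.sqrt (2 * n%:R : R)).
have /andP[sle slt] : (s%:R <= Num.sqrt (2 * n%:R : R) < s.+1%:R).
  by apply: truncn_itv; exact: sqrtr_ge0.
have n2s : (n.*2 < s.+1 ^ 2)%N.
  rewrite -(ltr_nat R) natrX -mul2n natrM -[ltLHS]sqr_sqrtr; last exact: mulr_ge0.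
  by rewrite ltr_pXn2r ?nnegrE ?sqrtr_ge0.
have n0 : (0 < n)%N by lia.
have n20 : 0 < 2 * n%:R :> R by rewrite mulr_gt0 ?ltr0n.
have l2 : 1 <= 2 * ln 2 :> R.
  have := expR_ge1Dx (- ln (2 : R)); rewrite expRN lnK ?posrE //; lra.
have lN : 0 <= ln (2 * n%:R : R).
  by apply: ln_ge0; rewrite -natrM ler1n; lia.
have main : (4 ^ n <= n.*2 ^ (1 + s + Z) * 4 ^ (n.*2 %/ 3))%N.
  apply: leq_trans (central_bin_ge n0) _; rewrite !expnD expn1 -!mulnA leq_mul2l.
  by apply/orP; right; have := central_bin_le n4 n2s; rewrite -/Z; lia.
have : ln (4 ^+ n) <= ln ((2 * n%:R) ^+ (1 + s + Z) * 4 ^+ (n.*2 %/ 3)) :> R.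
  rewrite ler_ln ?posrE ?mulr_gt0 ?exprn_gt0 //.
  by move: main; rewrite -(ler_nat R) natrM !natrX -mul2n natrM.
rewrite lnM ?posrE ?exprn_gt0 // !lnXn //.
rewrite -[ln 4 *+ n]mulr_natl -[ln 4 *+ _]mulr_natl -[ln _ *+ (1 + s + Z)]mulr_natl !natrD.
have -> : ln (4 : R) = 2 * ln 2.
  by rewrite (_ : 4 = 2 ^+ 2) ?lnXn // ?mulr_natl //; rewrite -natrX.
have d3 : (n.*2 %/ 3)%:R <= 2 * n%:R / 3 :> R.
  by rewrite ler_pdivlMr // -!natrM ler_nat mul2n leq_trunc_div.
move: (ln 2) (ln (2 * n%:R)) l2 lN => a l a1 l0 H.
have h1 : n%:R / 3 <= n%:R / 3 * (2 * a) by apply: ler_peMr => //; apply: divr_ge0.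
have h2 : (n.*2 %/ 3)%:R * (2 * a) <= 2 * n%:R / 3 * (2 * a).
  by apply: ler_wpM2r => //; lra.
apply: le_trans (_ : (1 + s%:R + Z%:R) * l <= _); first by lra.
by apply: ler_wpM2r => //; lra.
Qed.

Lemma prime_count_interval_ge (R : realType) :
  exists c y0 : R, 0 < c /\ forall y, y0 <= y ->
  exists P : seq nat, [/\ uniq P,
    {in P, forall p, prime p /\ (Num.truncn y < p <= 2 * Num.truncn y)%N} &
    c * (y / ln y) <= (size P)%:R].
Proof.
have [y1 y1P] := ln_pow_le_sqrt (72 : R) 1.
(* Beyond this threshold 72 ln y <= sqrt y, so the errors from sqrt(2n) and from rounding y take
   only a fraction of y/3; the value 1/24 leaves room to spare. *)
exists (24^-1), (Num.max y1 (expR 9)); split; first by lra.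
move=> y; rewrite ge_max => /andP[/y1P]; rewrite expr1 => Hsqrt y9.
have e9 := expR_ge1Dx (9 : R).
have ypos : 0 < y by lra.
have t1 : 9 <= ln y by rewrite -ler_expR lnK.
set n := Num.truncn y; have /andP[ny yn] : n%:R <= y < n.+1%:R.
  by apply: truncn_itv; lra.
rewrite -natr1 in yn.
have n4 : (4 < n)%N by rewrite -(ltr_nat R); lra.
exists [seq p <- iota n.+1 n | prime p]; split.
- by rewrite filter_uniq ?iota_uniq.
- by move=> p; rewrite mem_filter mem_iota => /andP[pp]; split; lia.
have := @prime_count_ge R n n4; have := ler0n R (size [seq p <- iota n.+1 n | prime p]).
move: (size _)%:R => Z Z0.
have l0 : 0 <= ln (2 * n%:R : R) by apply: ln_ge0; lra.
have l2t : ln (2 * n%:R) <= 2 * ln y.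
  rewrite [2 * ln y]mulr_natl -lnXn // ler_ln ?posrE ?exprn_gt0 //.
    by have : 2 * y <= y * y; [rewrite ler_wpM2r|rewrite expr2]; lra.
  by lra.
have w0 := sqrtr_ge0 y.
have sq : Num.sqrt (2 * n%:R) <= 2 * Num.sqrt y.
  have -> : 2 * Num.sqrt y = Num.sqrt (4 * y).
    rewrite sqrtrM //; congr (_ * _).
    by rewrite (_ : 4 = 2 ^+ 2) ?sqrtr_sqr ?ger0_norm // -natrX.
  by rewrite ler_sqrt; lra.
have yE : y = Num.sqrt y ^+ 2 by rewrite sqr_sqrtr // ltW.
move=> H.
have : n%:R / 3 <= (Z + 2 * Num.sqrt y + 1) * (2 * ln y).
  apply: le_trans H _; apply: ler_pM => //; last by lra.
  by have := sqrtr_ge0 (2 * n%:R : R); lra.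
move=> Hn; rewrite mulrA ler_pdivrMr; last by lra.
move: (Num.sqrt y) (ln y) Hsqrt w0 yE t1 Hn => u t Htu u0 yE t1 Hn.
have ut : u * (72 * t) <= u * u by rewrite ler_wpM2l.
have uu : 9 * u <= u * u by rewrite ler_wpM2r //; lra.
by move: yE; rewrite expr2; lra.
Qed.

(** The second size condition of the sieve, with u = sqrt x, t = ln x, k = #S and z = #P. The left
    side is O(u^2 t^5), dominated by b, and the right side is at least c^2 u^3/t, so u need only
    dominate t^6. *)
Lemma sieve_range_le (R : realFieldType) (c u t n l b k z : R) :
  0 < c -> 1 <= t -> t <= u -> 8 * (5 + 512 / c) / c ^+ 2 * t ^+ 6 <= u ->
  0 <= l <= u * t -> n <= u ^+ 2 -> 0 <= b -> b * z <= 512 * l ^+ 4 ->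
  c * (u ^+ 2 / t) <= z -> c * u <= k ->
  8 * (n + n + 1 + (b + 1) + l) <= k * z.
Proof.
move=> c0 t1 tu Ku /andP[l0 lut] nu b0 bz zc kc.
have t0 : 0 < t by lra.
have u0 : 0 < u by lra.
have u20 : 0 < u ^+ 2 by rewrite exprn_gt0.
have t51 : 1 <= t ^+ 5 by rewrite exprn_ege1.
have u2t5 : u ^+ 2 <= u ^+ 2 * t ^+ 5 by rewrite ler_peMr // ltW.
have one_u2 : 1 <= u ^+ 2 by rewrite exprn_ege1 //; lra.
have lu2 : l <= u ^+ 2 by apply: le_trans lut _; rewrite expr2 ler_pM2l.
have b_le : b <= 512 / c * (u ^+ 2 * t ^+ 5).
  have d0 : 0 < c * (u ^+ 2 / t) by rewrite mulr_gt0 ?divr_gt0.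
  rewrite -(ler_pM2r d0); apply: le_trans (_ : b * z <= _); first by rewrite ler_wpM2l.
  apply: le_trans bz _.
  have -> : 512 / c * (u ^+ 2 * t ^+ 5) * (c * (u ^+ 2 / t)) = 512 * (u * t) ^+ 4.
    by field; rewrite !gt_eqF.
  by rewrite ler_wpM2l // lerXn2r // nnegrE; rewrite mulr_ge0 ?ltW.
(* The 5 counts the terms n, n, 1, 1, l, each at most u^2 t^5; 512/c comes from b. *)
apply: le_trans (_ : 8 * (5 + 512 / c) * (u ^+ 2 * t ^+ 5) <= _); first by lra.
apply: le_trans (_ : (c * u) * (c * (u ^+ 2 / t)) <= _); last first.
  by apply: ler_pM => //; apply: ltW; rewrite ?mulr_gt0 ?invr_gt0.
have -> : 8 * (5 + 512 / c) * (u ^+ 2 * t ^+ 5) =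
    8 * (5 + 512 / c) / c ^+ 2 * t ^+ 6 * (c ^+ 2 * u ^+ 2 / t).
  by field; rewrite !gt_eqF.
have -> : (c * u) * (c * (u ^+ 2 / t)) = u * (c ^+ 2 * u ^+ 2 / t) by field; rewrite gt_eqF.
by rewrite ler_wpM2r // divr_ge0 ?mulr_ge0 ?exprn_ge0 ?ltW.
Qed.

Lemma truncn_double_bounds (R : realType) (y : R) (p : nat) : 0 <= y ->
  (Num.truncn y < p <= 2 * Num.truncn y)%N -> y < p%:R <= 2 * y.
Proof.
move=> y0 /andP[lp pl]; have /andP[ly yl] := truncn_itv y0; apply/andP; split.
  by apply: lt_le_trans yl _; rewrite ler_nat.
apply: le_trans (_ : (2 * Num.truncn y)%:R <= _); first by rewrite ler_nat.
by rewrite natrM ler_wpM2l.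
Qed.

Theorem theorem3 (R : realType) :
  exists c3 x0 : R, 0 < c3 /\
  forall x : R, x0 <= x ->
  exists q r : nat,
    [/\ prime q, prime r & q <> r] /\
    x < q%:R <= 2 * x /\
    Num.sqrt x * ln x < r%:R <= 2 * Num.sqrt x * ln x /\
    B3 (q * r ^ 2)%N /\
    exists parents : seq nat,
      [/\ uniq parents,
          c3 * (Num.sqrt x / ln x ^+ 2) <= (size parents)%:R &
          forall m : nat, m \in parents ->
            B3_parent (q * r ^ 2)%N m /\
            exists p : nat,
              [/\ prime p, p <> q, x < p%:R <= 2 * x & m = (p * q ^ 2)%N]].
Proof.
have [c [y0 [c0 cheb]]] := prime_count_interval_ge R.
pose K : R := 8 * (5 + 512 / c) / c ^+ 2.
have K0 : 0 <= K by rewrite divr_ge0 ?sqr_ge0 // mulr_ge0 // addr_ge0 // divr_ge0 // ltW.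
(* The three summands yield 2t <= u, y0 <= u and K t^6 <= u. *)
have [x1 x1P] := ln_pow_le_sqrt (2 + `|y0| + K) 6.
(* The number k of parents satisfies #P <= 2rk <= 4utk, while #P >= c u^2/t; hence c/4. *)
exists (c / 4), (Num.max x1 (expR 2)); split; first by lra.
move=> x; rewrite ge_max => /andP[/x1P Ku x2].
have x0 : 0 < x by apply: lt_le_trans x2; exact: expR_gt0.
have xE : x = Num.sqrt x ^+ 2 by rewrite sqr_sqrtr // ltW.
have t2 : 2 <= ln x by rewrite -ler_expR lnK.
set u := Num.sqrt x in Ku xE *; set t := ln x in Ku t2 *.
have t0 : 0 < t by lra.
have t61 : t <= t ^+ 6 by rewrite ler_eXnr //; lra.
have y0n := normr_ge0 y0; have y0l := ler_norm y0.
have yt : `|y0| <= `|y0| * t ^+ 6 by rewrite ler_peMr //; lra.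
have Kt : 0 <= K * t ^+ 6 by rewrite mulr_ge0 // exprn_ge0 // ltW.
have u2t : 2 * t <= u by lra.
have Ktu : K * t ^+ 6 <= u by lra.
have uy0 : y0 <= u by lra.
have u0 : 0 < u by lra.
have uut : u <= u * t by rewrite ler_peMr //; lra.
have ut2x : 2 * (u * t) <= x by rewrite xE expr2 mulrCA ler_pM2l.
have ux : u <= x by lra.
have [P [uP Pb Pc]] := cheb x (le_trans uy0 ux).
have [S [uS Sb Sc]] := cheb (u * t) (le_trans uy0 uut).
set n := Num.truncn x in Pb; set L := Num.truncn (u * t) in Sb.
have ut0 : 0 <= u * t by rewrite mulr_ge0 ?ltW.
have /andP[Lut _] : L%:R <= u * t < L.+1%:R by exact: truncn_itv.
have L0 : (0 < L)%N by rewrite truncn_gt0; lra.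
have z0 : 0 < (size P)%:R :> R.
  by apply: lt_le_trans Pc; rewrite mulr_gt0 // divr_gt0.
have z0' : (0 < size P)%N by rewrite -(ltr_nat R).
(* [B] is taken as b+1 with b the integer quotient: large enough for the cross terms, yet of order x
   (log x)^5. *)
have [b [b_ge b_le]] : exists b : nat,
    (512 * L ^ 4 <= b.+1 * size P)%N /\ (b * size P <= 512 * L ^ 4)%N.
  by exists (512 * L ^ 4 %/ size P)%N; rewrite leq_trunc_div ltnW ?ltn_ceil.
(* Since ut <= x, ln(ut) is at most t and cancels against the factor t in ut. *)
have cu : c * u <= (size S)%:R.
  apply: le_trans Sc; rewrite ler_wpM2l ?(ltW c0) //.
  have ln0 : 0 < ln (u * t) by apply: ln_gt0; lra.
  rewrite ler_pdivlMr // ler_wpM2l ?(ltW u0) // ler_ln ?posrE ?mulr_gt0 //; lra.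
have cond2 : (8 * (n.*2.+1 + b.+1 + L) <= size S * size P)%N.
  rewrite -[n.*2.+1]addn1 -[b.+1]addn1 -addnn.
  rewrite -(ler_nat R) !natrM !natrD.
  apply: (sieve_range_le (c := c) (u := u) (t := t)) => //.
  - by lra.
  - by lra.
  - by rewrite Lut ler0n.
  - by rewrite -xE truncn_le ltW.
  - by rewrite -natrX -!natrM ler_nat.
  - by rewrite -xE.
have [|||r [q [rS qP cnt]]] :=
    exists_opposite_residue (N := n.*2.+1) (B := b.+1) (L := L) uP _ uS _ L0 _ cond2.
- by move=> p /Pb[_ /andP[_]]; rewrite mul2n.
- by move=> r /Sb[pr /andP[Lr rL]]; rewrite pr ltnW.
- exact: b_ge.
have [pq qb] := Pb q qP; have [pr rb] := Sb r rS.
have qx := truncn_double_bounds (ltW x0) qb.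
have rx := truncn_double_bounds ut0 rb.
have r2q : (2 < r < q)%N.
  rewrite -!(ltr_nat R); move/andP: qx => [xq _]; move/andP: rx => [ru r2].
  by apply/andP; split; lra.
have qr : q != r by move/andP: r2q => [_ rq]; rewrite gtn_eqF.
exists q, r; split; first by split=> //; exact/eqP.
split=> //; split; first by rewrite -mulrA.
have parentP p : p \in P -> (r %| p + q)%N ->
    p <> q /\ B3_parent (q * r ^ 2)%N (p * q ^ 2)%N.
  move=> pP rpq; have [pp pb] := Pb p pP.
  apply: B3_parent_of_dvd => //; rewrite -(ltr_nat R) natrD natrX.
  have /andP[_ px] := truncn_double_bounds (ltW x0) pb.
  have /andP[_ qx2] := qx.
  have /andP[ru _] := rx.
  (* p + q <= 4x <= x t^2 = (ut)^2 < r^2, by t >= 2. *)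
  apply: le_lt_trans (_ : (u * t) ^+ 2 < _).
    apply: le_trans (_ : x * 2 ^+ 2 <= _); first by rewrite expr2; lra.
    rewrite exprMn -xE ler_pM2l // lerXn2r // nnegrE //; lra.
  by rewrite ltrXn2r // nnegrE.
split; first exact: B3_mul_sqr.
exists [seq (p * q ^ 2)%N | p <- P & (r %| p + q)%N]; split.
- rewrite map_inj_uniq ?filter_uniq // => a b' /eqP.
  by rewrite eqn_pmul2r ?expn_gt0 ?prime_gt0 // => /eqP.
- rewrite size_map size_filter; set k := count _ _ in cnt *.
  have cnt' : (size P)%:R <= 4 * (u * t) * k%:R :> R.
    apply: le_trans (_ : (2 * r * k)%:R <= _); first by rewrite ler_nat.
    rewrite !natrM ler_wpM2r //; move/andP: rx => [_]; lra.
  rewrite -(ler_pM2l (_ : 0 < 4 * (u * t))); last by rewrite mulr_gt0 ?mulr_gt0.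
  apply: le_trans cnt'; apply: le_trans Pc.
  rewrite -/t xE le_eqVlt; apply/orP; left; apply/eqP; field; exact: lt0r_neq0.
- move=> m /mapP[p]; rewrite mem_filter => /andP[rpq pP] ->.
  have [neq par] := parentP p pP rpq; have [pp pb] := Pb p pP.
  by split=> //; exists p; split=> //; exact: truncn_double_bounds (ltW x0) pb.
Qed.
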